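(* Let $H=(V,E)$ be a $k$-uniform hypergraph such that $\deg_H(u)\equiv 0 \pmod{k}$ for every vertex $u$ of $H$. Then $H$ has no cut edges.
   Context: A hypergraph $H=(V,E)$ consists of a nonempty finite vertex set $V$, a finite edge set $E$, and an incidence function $\psi:E\to 2^V$; edges are identified with their vertex sets (parallel edges allowed). $H$ is $k$-uniform if $|e|=k$ for all $e\in E$. $\deg_H(u)$ is the number of edges containing $u$. Two distinct vertices are adjacent via $e$ if both lie in $e$; a walk is a sequence $v_0e_1v_1\dots e_kv_k$ with $v_{i-1},v_i$ adjacent via $e_i$. For an equivalence class $V'$ of ''joined by a walk'', the connected component is $(V',\{f\in E:\emptyset\ne f\subseteq V'\})$; $\omega(H)$ is the number of components. $H-e=(V,E\setminus\{e\})$, and $e$ is a cut edge if $\omega(H-e)>\omega(H)$. *)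

(* Defs.v *)
From mathcomp Require Import all_boot.
Set Implicit Arguments.
Unset Strict Implicit.
Unset Printing Implicit Defensive.

(* Edges form a separate type, so parallel edges and empty edges are allowed. *)
Record hypergraph := Hypergraph {
  vertex : finType;
  edge : finType;
  incidence : edge -> {set vertex};
  vertex_nonempty : 0 < #|vertex|
}.

Definition uniform (k : nat) (H : hypergraph) : Prop :=
  forall e : edge H, #|incidence e| = k.

Definition deg (H : hypergraph) (u : vertex H) : nat :=
  #|[set e : edge H | u \in incidence e]|.

Definition adjacent_via (H : hypergraph) (e : edge H) (u v : vertex H) : bool :=
  [&& u != v, u \in incidence e & v \in incidence e].

(* The walk v0 e1 v1 ... ek vk is encoded by its origin v0 together with the
   sequence [:: (e1, v1); ...; (ek, vk)]. *)
Fixpoint is_walk (H : hypergraph) (v0 : vertex H)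
    (p : seq (edge H * vertex H)) : bool :=
  if p is (e, v) :: p' then adjacent_via e v0 v && is_walk v p' else true.

Definition walk_end (H : hypergraph) (v0 : vertex H)
    (p : seq (edge H * vertex H)) : vertex H :=
  last v0 [seq s.2 | s <- p].

Definition joined_by_walk (H : hypergraph) (u v : vertex H) : Prop :=
  exists2 p, is_walk u p & walk_end u p = v.

Definition adjacent (H : hypergraph) : rel (vertex H) :=
  fun u v => [exists e, adjacent_via e u v].

(* Boolean counterpart of [joined_by_walk], see [joinedP]. *)
Definition joined (H : hypergraph) : rel (vertex H) := connect (@adjacent H).

Lemma joinedP (H : hypergraph) (u v : vertex H) :
  reflect (joined_by_walk u v) (joined u v).
Proof.
apply: (iffP connectP) => [[p] | [p]].
  elim: p u => [|w p IHp] u /=; first by move=> _ ->; exists [::].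
  case/andP=> /existsP[e uew] /IHp{}IHp /IHp[q walk_q end_q].
  by exists ((e, w) :: q) => //=; rewrite uew.
elim: p u => [|[e w] p IHp] u /=; first by move=> _ <-; exists [::].
case/andP=> uew walk_p end_p; have [q path_q ->] := IHp w walk_p end_p.
by exists (w :: q); rewrite //= path_q andbT; apply/existsP; exists e.
Qed.

Lemma joined_equiv (H : hypergraph) : equivalence_rel (@joined H).
Proof.
have symH : connect_sym (@adjacent H).
  apply: sym_connect_sym => u v; apply: eq_existsb => e.
  by rewrite /adjacent_via eq_sym [X in _ && X]andbC.
move=> u v w; split=> [|uv]; first exact: connect0.
exact: (same_connect symH uv).
Qed.

(* The connected component (V', {f in E : f nonempty, f \subset V'}). *)
Definition component_on (H : hypergraph) (V' : {set vertex H}) :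
    {set vertex H} * {set edge H} :=
  (V', [set f | (incidence f != set0) && (incidence f \subset V')]).

Definition components (H : hypergraph) : {set {set vertex H} * {set edge H}} :=
  [set component_on V' | V' in equivalence_partition (@joined H) [set: vertex H]].

Definition omega (H : hypergraph) : nat := #|components H|.

Definition delete_edge (H : hypergraph) (e : edge H) : hypergraph :=
  @Hypergraph (vertex H) {f : edge H | f != e} (fun f => incidence (val f))
    (vertex_nonempty H).

Definition cut_edge (H : hypergraph) (e : edge H) : bool :=
  omega H < omega (delete_edge e).

(* Main.v *)
Require Import Defs.
From mathcomp Require Import all_boot.

(** Let [C] be a component of [H - e] meeting [e]. Every edge other than [e]
    meets [C] in 0 or [k] vertices, and the degrees of the vertices of [C] add up
    to a multiple of [k], so [k] also divides the size of [e :&: C]. As this set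
    is nonempty and [e] has [k] vertices, [e] lies inside [C], hence deleting [e]
    does not change which vertices are joined. *)

(** Double counting of the pairs of a vertex of [C] and an edge containing it. *)
Lemma sum_deg (H : hypergraph) (C : {set vertex H}) :
  \sum_(v in C) deg v = \sum_(f : edge H) #|incidence f :&: C|.
Proof.
under eq_bigr => v _ do rewrite /deg -sum1dep_card big_mkcond.
rewrite exchange_big /=; apply: eq_bigr => f _.
rewrite -big_mkcondr sum1dep_card; apply: eq_card => v.
by rewrite !inE andbC.
Qed.

Lemma incidence_joined (H : hypergraph) (f : edge H) (u v : vertex H) :
  u \in incidence f -> v \in incidence f -> joined u v.
Proof.
move=> uf vf; have [->|uv] := eqVneq u v; first exact: connect0.
by apply/connect1/existsP; exists f; rewrite /adjacent_via uv uf.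
Qed.

(** A component records its vertex set, so [component_on] is injective and counting components
    amounts to counting classes. *)
Lemma omegaE (H : hypergraph) :
  omega H = #|equivalence_partition (@joined H) [set: vertex H]|.
Proof. by apply: card_imset => A B []. Qed.

(** A step along [e] in a walk of [H] can be replaced by a walk avoiding [e]; steps along other
    edges survive. *)
Lemma delete_edge_joined (H : hypergraph) (e : edge H) :
    (forall u v : vertex H, u \in incidence e -> v \in incidence e ->
      @joined (delete_edge e) u v) ->
  forall u v : vertex H, @joined (delete_edge e) u v = joined u v.
Proof.
move=> joined_e u v; apply/idP/idP; apply: connect_sub => {}u {}v.
  by case/existsP=> f uv; apply/connect1/existsP; exists (val f).
case/existsP=> f; have [->|fe] := eqVneq f e => /and3P[uv uf vf].
  exact: joined_e.
exact: (@incidence_joined (delete_edge e) (Sub f fe)).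
Qed.

Lemma omega_delete_edge (H : hypergraph) (e : edge H) :
    (forall u v : vertex H, u \in incidence e -> v \in incidence e ->
      @joined (delete_edge e) u v) ->
  omega (delete_edge e) = omega H.
Proof.
(* [H] and [H - e] share their vertex type, so the two partitions can be compared as sets. *)
move/delete_edge_joined=> joinedE; rewrite !omegaE; congr #|pred_of_set _|.
apply: eq_imset => u; apply/setP=> v.
by rewrite !inE; congr (_ && _); apply: joinedE.
Qed.

(** As [f] is still an edge of [H - e], its vertices are joined there: [f] misses the class of [u]
    or lies inside it. *)
Lemma dvdn_incidence_component (H : hypergraph) (k : nat) (e f : edge H)
    (u : vertex H) :
    uniform k H -> f != e ->
  k %| #|incidence f :&: [set v | @joined (delete_edge e) u v]|.
Proof.
move=> uniformH fe; set C := [set v | _].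
have [->|[w]] := set_0Vmem (incidence f :&: C); first by rewrite cards0.
rewrite !inE => /andP[wf uw].
suff /setIidPl-> : incidence f \subset C by rewrite uniformH.
apply/subsetP=> v vf; rewrite inE; apply: connect_trans uw _.
exact: (@incidence_joined (delete_edge e) (Sub f fe)).
Qed.

Theorem theorem3p21 (H : hypergraph) (k : nat)
    (uniformH : uniform k H)
    (degH : forall u : vertex H, deg u = 0 %[mod k]) :
  forall e : edge H, ~~ cut_edge e.
Proof.
move=> e; rewrite /cut_edge omega_delete_edge ?ltnn // => u v ue ve.
pose C : {set vertex H} := [set w | @joined (delete_edge e) u w].
have k_eC : k %| #|incidence e :&: C|.
  have : k %| \sum_(w in C) deg w.
    by apply: dvdn_sum => w _; rewrite /dvdn degH mod0n.
  rewrite sum_deg (bigD1 e) //= dvdn_addl //.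
  by apply: dvdn_sum => f fe; apply: dvdn_incidence_component.
have eC_gt0 : 0 < #|incidence e :&: C|.
  by apply/card_gt0P; exists u; rewrite !inE ue; apply: connect0.
(* A positive multiple of [k] is at least [k], the size of [e], so the intersection is all of
   [e]. *)
have /setIidPl/subsetP/(_ v ve) : incidence e :&: C = incidence e.
  by apply/eqP; rewrite eqEcard subsetIl uniformH dvdn_leq.
by rewrite inE.
Qed.
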